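(* Let $\mathcal X\subseteq\mathbb R^n$ be closed and convex and let $f:\mathcal X\to\mathbb R$ be $1$-strongly convex and $1$-Lipschitz, with minimizer $x^*=\arg\min_{x\in\mathcal X}f(x)$. Run projected stochastic gradient descent for $T$ iterations from any $x_1\in\mathcal X$ with step sizes $\eta_t=1/t$, where the noise $\hat z_t$ of the stochastic gradient oracle satisfies $\|\hat z_t\|\le 1$ almost surely. Then for every $\delta\in(0,1)$, with probability at least $1-\delta$, \[ f(x_{T+1})-f(x^* )\le O\!\left(\frac{\log(T)\log(1/\delta)}{T}\right). \]
   Context: $\|\cdot\|$ is the Euclidean norm. $f$ is $\alpha$-strongly convex if $f(y)\ge f(x)+\langle g,y-x\rangle+\frac{\alpha}{2}\|y-x\|^2$ for all $x,y\in\mathcal X$, $g\in\partial f(x)$; $f$ is $L$-Lipschitz if $\|g\|\le L$ for all $x\in\mathcal X$, $g\in\partial f(x)$. Projected SGD: at step $t$ the oracle, queried at $x_t$, returns $\hat g_t=g_t-\hat z_t$ with $g_t\in\partial f(x_t)$ and $\mathbb E[\hat z_t\mid \mathcal F_{t-1}]=0$, where $\mathcal F_{t}=\sigma(\hat z_1,\dots,\hat z_t)$; then $y_{t+1}=x_t-\eta_t\hat g_t$ and $x_{t+1}=\Pi_{\mathcal X}(y_{t+1})$, the Euclidean projection onto $\mathcal X$. The $O(\cdot)$ hides an absolute constant.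
   Formalization: Proved for T ≥ 2 and δ in (0, 1/2]: for T = 1, and as δ tends to 1, the stated bound tends to 0 or is 0 and fails (f(x)=x²/2 on [-1,1] with ±1 noise). The subgradient g_t is taken to be F_{t-1}-measurable. *)

(* Defs.v *)
From HB Require Import structures.
From mathcomp Require Import all_boot all_order all_algebra.
From mathcomp Require Import all_classical all_reals all_analysis.
Set Implicit Arguments. Unset Strict Implicit. Unset Printing Implicit Defensive.
Import Order.TTheory GRing.Theory Num.Theory.
Import numFieldNormedType.Exports.
Local Open Scope classical_set_scope.
Local Open Scope ring_scope.

Section Defs.
Context {R : realType} {n : nat}.

Definition dotv (u v : 'rV[R]_n) : R := \sum_(i < n) u 0 i * v 0 i.
Definition normv (u : 'rV[R]_n) : R := Num.sqrt (dotv u u).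

Definition euclid_convex_set (X : set 'rV[R]_n) : Prop :=
  forall x y (l : R), X x -> X y -> 0 <= l <= 1 -> X (l *: x + (1 - l) *: y).

Definition subgrad (f : 'rV[R]_n -> R) (x g : 'rV[R]_n) : Prop :=
  forall y, f x + dotv g (y - x) <= f y.

Definition sg_strongly_convex_on (X : set 'rV[R]_n) (alpha : R) (f : 'rV[R]_n -> R) :=
  forall x y g, X x -> X y -> subgrad f x g ->
    f x + dotv g (y - x) + alpha / 2 * normv (y - x) ^+ 2 <= f y.

Definition sg_lipschitz_on (X : set 'rV[R]_n) (L : R) (f : 'rV[R]_n -> R) :=
  forall x g, X x -> subgrad f x g -> normv g <= L.

Definition is_proj (X : set 'rV[R]_n) (y p : 'rV[R]_n) : Prop :=
  X p /\ forall q, X q -> normv (y - p) <= normv (y - q).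

End Defs.

Definition noise_filtration {R : realType} {n : nat} {d : measure_display}
  {T : measurableType d} (z : nat -> T -> 'rV[R]_n) (t : nat) : set (set T) :=
  <<s [set A | exists (s : nat) (i : 'I_n) (B : set R),
        [/\ (1 <= s <= t)%N, measurable B & A = (fun w => z s w 0 i) @^-1` B] ] >>.

Definition measurable_wrt {R : realType} {T : Type} (F : set (set T)) (h : T -> R) :=
  forall B : set R, measurable B -> F (h @^-1` B).

(* Main.v *)
(* Write F_t = f(x_t) - f(x^* ), N for the number of steps and w_k = 1/(N+1-k).
   Compare the iterates with the moving reference points u_0 = x^*,
   u_{k+1} = u_k + w_k (x_{k+1} - u_k), and let phi_k be the same average of
   the F_t, started at 0.  Since w_{k+1} (F_{k+1} - phi_{k+1}) =
   phi_{k+1} - phi_k, weighting the one-step inequality of SGD against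
   u_{k+1} by w_{k+1} telescopes to a bound on phi_N >= F_N / 2.  As
   x_{k+1} - u_{k+1} = (1 - w_k)(x_{k+1} - u_k), this telescoping leaves over a
   negative multiple of |x_{k+1} - u_k|^2, and a slowly decreasing extra factor
   2 - H_k / H_N (harmonic numbers) supplies one for small k as well.  The noise
   enters linearly, as <z_{k+1}, v_k> with v_k proportional to x_{k+1} - u_k,
   so altogether F_N is at most O(log N / N) plus
   sum_k (<z_{k+1}, v_k> - 2 lambda |v_k|^2) with lambda of order N / log N.
   By e^s <= s + e^{2 s^2}, exp of lambda times this sum is a supermartingale,
   and Markov's inequality concludes.  Passing from x_N to x_{N+1} costs one
   Lipschitz step. *)
Require Import Defs.
From HB Require Import structures.
From mathcomp Require Import all_boot all_order all_algebra.
From mathcomp Require Import all_classical all_reals all_analysis.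
From mathcomp Require Import measurable_realfun ring lra.
Import Order.TTheory GRing.Theory Num.Theory.
Import numFieldNormedType.Exports.
Set Implicit Arguments. Unset Strict Implicit. Unset Printing Implicit Defensive.
Local Open Scope classical_set_scope.
Local Open Scope ring_scope.

(** * Euclidean geometry and projections onto convex sets *)

Section Euclid.
Context {R : realType} {n : nat}.
Implicit Types (u v w x y p q g : 'rV[R]_n) (a : R).

Lemma dotvC u v : dotv u v = dotv v u.
Proof. by apply: eq_bigr => i _; rewrite mulrC. Qed.

Lemma dotvDl u v w : dotv (u + v) w = dotv u w + dotv v w.
Proof. by rewrite -big_split; apply: eq_bigr => i _; rewrite mxE mulrDl. Qed.

Lemma dotvZl a u v : dotv (a *: u) v = a * dotv u v.
Proof. by rewrite mulr_sumr; apply: eq_bigr => i _; rewrite mxE mulrA. Qed.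

Lemma dotvNl u v : dotv (- u) v = - dotv u v.
Proof. by rewrite -scaleN1r dotvZl mulN1r. Qed.

Lemma dotvDr u v w : dotv u (v + w) = dotv u v + dotv u w.
Proof. by rewrite dotvC dotvDl !(dotvC _ u). Qed.

Lemma dotvZr a u v : dotv u (a *: v) = a * dotv u v.
Proof. by rewrite dotvC dotvZl (dotvC v). Qed.

Lemma dotvNr u v : dotv u (- v) = - dotv u v.
Proof. by rewrite dotvC dotvNl (dotvC v). Qed.

Definition dotvE := (dotvDl, dotvDr, dotvNl, dotvNr, dotvZl, dotvZr).

Lemma dotvv_ge0 u : 0 <= dotv u u.
Proof. by apply: sumr_ge0 => i _; rewrite -expr2 sqr_ge0. Qed.

Lemma normv_ge0 u : 0 <= normv u.
Proof. exact: sqrtr_ge0. Qed.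

Lemma sqr_normv u : normv u ^+ 2 = dotv u u.
Proof. by rewrite sqr_sqrtr ?dotvv_ge0. Qed.

Lemma normv_le a u : 0 <= a -> (normv u <= a) = (dotv u u <= a ^+ 2).
Proof. by move=> a0; rewrite -sqr_normv ler_sqr ?nnegrE ?normv_ge0. Qed.

Lemma cauchy_schwarz u v : dotv u v ^+ 2 <= dotv u u * dotv v v.
Proof.
have := dotvv_ge0 v; rewrite le_eqVlt => /orP[/eqP v0|v0].
  suff -> : v = 0.
    by rewrite -(scale0r (0 : 'rV[R]_n)) !dotvZr !mul0r expr0n mulr0.
  apply/rowP => i; rewrite mxE; apply/eqP; rewrite -sqrf_eq0 expr2.
  by have /psumr_eq0P/(_ i isT)-> // := esym v0; move=> j _; rewrite -expr2 sqr_ge0.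
have := dotvv_ge0 (dotv v v *: u - dotv u v *: v).
rewrite !dotvE (dotvC v u) => h.
rewrite -subr_ge0 -(pmulr_rge0 _ v0); apply: le_trans h _.
by rewrite le_eqVlt; apply/orP; left; apply/eqP; ring.
Qed.

Lemma ler_dotv u v : `|dotv u v| <= normv u * normv v.
Proof.
rewrite -sqrtr_sqr -sqrtrM ?dotvv_ge0 //.
by rewrite ler_wsqrtr // cauchy_schwarz.
Qed.

Lemma ler_normvD u v : normv (u + v) <= normv u + normv v.
Proof.
rewrite normv_le ?addr_ge0 ?normv_ge0 // !dotvE (dotvC v u).
have := le_trans (ler_norm _) (ler_dotv u v).
rewrite -!sqr_normv => h; lra.
Qed.

Lemma normvN u : normv (- u) = normv u.
Proof. by rewrite /normv !dotvE opprK. Qed.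

Lemma normvZ a u : normv (a *: u) = `|a| * normv u.
Proof. by rewrite /normv !dotvE mulrA -expr2 sqrtrM ?sqr_ge0 // sqrtr_sqr. Qed.

Lemma normvB u v : normv (u - v) = normv (v - u).
Proof. by rewrite -opprB normvN. Qed.

Lemma ler_coord_normv u i : `|u 0 i| <= normv u.
Proof.
rewrite -sqrtr_sqr ler_wsqrtr // /dotv (bigD1 i) //= -expr2 lerDl.
by apply: sumr_ge0 => j _; rewrite -expr2 sqr_ge0.
Qed.

Lemma ler_normv_coords u a :
  0 <= a -> (forall i, `|u 0 i| <= a) -> normv u <= n%:R * a.
Proof.
move=> a0 ua; rewrite normv_le ?mulr_ge0 //.
apply: (@le_trans _ _ (\sum_(i < n) a ^+ 2)).
  by apply: ler_sum => i _; rewrite -expr2 -real_normK ?num_real // lerXn2r ?nnegrE.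
rewrite sumr_const card_ord -[leLHS]mulr_natl exprMn.
apply: ler_wpM2r; first exact: sqr_ge0.
by rewrite -natrX ler_nat; case: (n) => // k; rewrite expnS expn1 leq_pmulr.
Qed.

(** If the inner product were positive, moving from [p] a small fraction towards [q] would come
    closer to [y], against the minimality of [p]. *)
Lemma is_proj_obtuse X y p q :
  euclid_convex_set X -> is_proj X y p -> X q -> dotv (y - p) (q - p) <= 0.
Proof.
move=> cX [Xp pmin] Xq; rewrite leNgt; apply/negP => c0.
set c := dotv _ _ in c0; set d := dotv (q - p) (q - p).
have d0 : 0 <= d by apply: dotvv_ge0.
have dc0 : 0 < d + c by rewrite ltr_wpDl.
(* Dividing by [d + c] instead of [d] gives [l <= 1] and [l * d < c], without a separate case
   [d = 0]. *)
pose l := c / (d + c).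
have l0 : 0 < l by rewrite divr_gt0.
have l1 : l <= 1 by rewrite ler_pdivrMr // mul1r lerDr.
have /pmin : X (l *: q + (1 - l) *: p) by apply: cX => //; rewrite ltW.
rewrite normv_le ?normv_ge0 // sqr_normv.
have yl : y - (l *: q + (1 - l) *: p) = (y - p) - l *: (q - p).
  by apply/rowP => i; rewrite !mxE; ring.
rewrite {}yl; move: @c @d @l c0 d0 dc0 l0 l1; move: (y - p) (q - p) => e h c d l c0 d0 dc0 l0 l1.
rewrite !dotvE (dotvC h e).
move=> le_e; have : 0 <= l * (l * d - 2 * c) by rewrite /d /c; lra.
rewrite pmulr_rge0 // => h2.
have : l * (d + c) = c by rewrite divfK ?gt_eqF.
have := mulr_gt0 l0 c0 => ? ?; lra.
Qed.

Lemma is_proj_dist_le X y p q : euclid_convex_set X -> is_proj X y p -> X q ->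
  dotv (p - q) (p - q) <= dotv (y - q) (y - q).
Proof.
move=> cX pP Xq; have := is_proj_obtuse cX pP Xq.
have -> : y - q = (y - p) + (p - q) by rewrite addrA subrK.
rewrite -(opprB p q); move: (y - p) (p - q) => e h.
rewrite !dotvE (dotvC h e); have := dotvv_ge0 e => ? ?; lra.
Qed.

(** Adding the obtuse-angle inequalities at [p] and [p'] shows that, in the square of (p - p') + ((y
    - p) - (y' - p')), the cross term is nonnegative. *)
Lemma is_proj_nonexpansive X y y' p p' :
  euclid_convex_set X -> is_proj X y p -> is_proj X y' p' ->
  normv (p - p') <= normv (y - y').
Proof.
move=> cX pP pP'.
have h1 := is_proj_obtuse cX pP pP'.1; have h2 := is_proj_obtuse cX pP' pP.1.
rewrite normv_le ?normv_ge0 // sqr_normv.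
have -> : y - y' = (p - p') + ((y - p) - (y' - p')).
  by apply/rowP => i; rewrite !mxE; ring.
move: h1 h2; rewrite -(opprB p p'); move: (y - p) (y' - p') (p - p') => e e' h.
have := dotvv_ge0 (e - e').
rewrite !dotvE (dotvC h e) (dotvC h e') => ? ? ?; lra.
Qed.

End Euclid.

(** * Harmonic sums, averaging weights and damping *)

Section Weights.
Context {R : realType}.
Implicit Types (N k : nat).

Definition harmonic_sum k : R := \sum_(i < k) (i.+1%:R)^-1.

Definition avg_weight N k : R := ((N.+1 - k)%:R)^-1.

Definition damping N k : R := 2 - harmonic_sum k / harmonic_sum N.

Lemma harmonic_sumS k : harmonic_sum k.+1 = harmonic_sum k + (k.+1%:R)^-1.
Proof. by rewrite /harmonic_sum big_ord_recr. Qed.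

Lemma harmonic_sum_ge0 k : 0 <= harmonic_sum k.
Proof. by apply: sumr_ge0 => i _; rewrite invr_ge0. Qed.

Lemma harmonic_sum_homo : {homo harmonic_sum : j k / (j <= k)%N >-> j <= k}.
Proof.
apply: homo_leq; [exact: lexx | exact: le_trans | move=> k].
by rewrite harmonic_sumS lerDl invr_ge0.
Qed.

Lemma harmonic_sum_ge1 N : (0 < N)%N -> 1 <= harmonic_sum N.
Proof.
by move=> /harmonic_sum_homo; rewrite harmonic_sumS /harmonic_sum big_ord0 add0r invr1.
Qed.

(** Each induction step is ln (1 - 1/K) <= -1/K for the new index K. *)
Lemma harmonic_sum_le_ln N : (0 < N)%N -> harmonic_sum N <= 1 + ln N%:R.
Proof.
case: N => // N _; elim: N => [|N IH].
  by rewrite harmonic_sumS /harmonic_sum big_ord0 add0r invr1 ln1 addr0.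
rewrite harmonic_sumS; have N1 : (0 : R) < N.+1%:R by rewrite ltr0n.
have N2 : (0 : R) < N.+2%:R by rewrite ltr0n.
have := @le_ln1Dx R (- (N.+2%:R)^-1).
have -> : 1 - (N.+2%:R)^-1 = N.+1%:R / N.+2%:R :> R.
  by rewrite -(natr1 N.+1); move: (N.+1%:R) N1 => K K0; field; rewrite gt_eqF //; lra.
rewrite lnM ?posrE ?invr_gt0 // lnV ?posrE // ltrN2 invf_lt1 // ltr1n => /(_ isT).
move: IH; move: (N.+2%:R^-1) (ln _) (ln _) (harmonic_sum _) => a b c e *; lra.
Qed.

Lemma damping_le2 N k : damping N k <= 2.
Proof. by rewrite lerBlDr lerDl divr_ge0 ?harmonic_sum_ge0. Qed.

Lemma damping_ge1 N k : (0 < N)%N -> (k <= N)%N -> 1 <= damping N k.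
Proof.
move=> N0 kN; have L1 := harmonic_sum_ge1 N0.
have : harmonic_sum k / harmonic_sum N <= 1.
  by rewrite ler_pdivrMr ?(lt_le_trans ltr01) // mul1r harmonic_sum_homo.
by rewrite /damping => ?; lra.
Qed.

Lemma damping_step N k :
  damping N k - damping N k.+1 = (k.+1%:R * harmonic_sum N)^-1.
Proof. by rewrite /damping harmonic_sumS invfM; ring. Qed.

Lemma avg_weight_ge0 N k : 0 <= avg_weight N k.
Proof. by rewrite invr_ge0. Qed.

Lemma avg_weight_le1 N k : avg_weight N k <= 1.
Proof.
rewrite /avg_weight; case: (N.+1 - k)%N => [|j]; first by rewrite invr0.
by rewrite invf_le1 ?ltr0n // ler1n.
Qed.

(** This identity drives the telescoping: it turns the weighted difference of gap and average into
    an increment of the average. It breaks at [k = N], where the left weight is the inverse of 0. *)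
Lemma avg_weightS N k : (k < N)%N ->
  avg_weight N k.+1 * (1 - avg_weight N k) = avg_weight N k.
Proof.
move=> kN; rewrite /avg_weight subSS subSn 1?ltnW // -natr1.
have : 0 < (N - k)%:R :> R by rewrite ltr0n subn_gt0.
by move=> h; field; apply/andP; split; rewrite gt_eqF // addr_gt0.
Qed.

(** Partial fractions: 1/((N-k)(k+1)) is 1/(N+1) times 1/(N-k) + 1/(k+1), and each piece sums to the
    harmonic sum. *)
Lemma sum_avg_weight_harmonic N : (0 < N)%N ->
  \sum_(k < N) avg_weight N k.+1 / k.+1%:R <= 2 * harmonic_sum N / N%:R.
Proof.
move=> N0; have N0' : 0 < N%:R :> R by rewrite ltr0n.
have -> : \sum_(k < N) avg_weight N k.+1 / k.+1%:R =
    (N.+1%:R)^-1 * (harmonic_sum N + harmonic_sum N).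
  have {1}-> : harmonic_sum N = \sum_(k < N) ((N - k)%:R)^-1.
    rewrite /harmonic_sum (reindex_inj rev_ord_inj) /=; apply: eq_bigr => k _.
    by rewrite subnS prednK // subn_gt0.
  rewrite mulrDr !mulr_sumr -big_split /=; apply: eq_bigr => k _.
  rewrite /avg_weight subSS natrB 1?ltnW // -!natr1.
  have h1 : k%:R + 1 <= N%:R :> R by rewrite natr1 ler_nat.
  have h2 : 0 <= k%:R :> R by [].
  field.
  by rewrite !gt_eqF //=; lra.
have L0 := harmonic_sum_ge0 N.
rewrite -mulr2n -[_ *+ 2]mulr_natl mulrC ler_wpM2l ?mulr_ge0 //.
by rewrite lef_pV2 ?posrE ?ltr0n // ler_nat.
Qed.

(** The parameter of the exponential moment. As [damping] is at most 2, the 64 makes 8 rate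
    damping^2 at most N / (2 H_N), which is what [damping_slack] can afford. *)
Definition rate N : R := N%:R / (64 * harmonic_sum N).

Lemma rate_gt0 N : (0 < N)%N -> 0 < rate N.
Proof.
move=> N0; rewrite divr_gt0 ?ltr0n // mulr_gt0 //.
by apply: lt_le_trans (harmonic_sum_ge1 N0).
Qed.

(* After multiplication by [(N + 1 - k)^2] the right-hand side is
   [k (N + 1 - k) / ((k + 1) L) + k damping]: the decrease of the damping pays
   for small [k], the averaging for large [k]. *)
Lemma damping_slack N k : (0 < k < N)%N ->
  8 * rate N * (damping N k.+1 * avg_weight N k) ^+ 2 <=
  k%:R * avg_weight N k *
    (damping N k - damping N k.+1 * (1 - avg_weight N k)).
Proof.
rewrite /rate => /andP[k0 kN]; have N0 := ltn_trans k0 kN.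
have L1 := harmonic_sum_ge1 N0.
have m2 := damping_le2 N k.+1; have m1 := damping_ge1 N0 kN.
have K1 : 1 <= k%:R :> R by rewrite ler1n.
have KN : k%:R + 1 <= N%:R :> R by rewrite natr1 ler_nat.
have -> : damping N k - damping N k.+1 * (1 - avg_weight N k) =
    (k.+1%:R * harmonic_sum N)^-1 + damping N k.+1 * avg_weight N k.
  by rewrite -damping_step; ring.
move: (damping N k.+1) m2 m1 => m m2 m1.
rewrite /avg_weight natrB; last by rewrite ltnW // ltnW.
rewrite -(natr1 N) -(natr1 k); move: (harmonic_sum N) L1 (k%:R) (N%:R) K1 KN => L L1 K M K1 KN.
have n0 : 0 < M + 1 - K by lra.
have -> : 8 * (M / (64 * L)) * (m * (M + 1 - K)^-1) ^+ 2 =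
    (M + 1 - K)^-1 ^+ 2 * (M / L * (m ^+ 2 / 8)).
  by field; rewrite !gt_eqF //; lra.
have -> : K * (M + 1 - K)^-1 * (((K + 1) * L)^-1 + m * (M + 1 - K)^-1) =
    (M + 1 - K)^-1 ^+ 2 * ((M + 1 - K) / L * (K / (K + 1)) + K * m).
  by field; rewrite !gt_eqF //; lra.
rewrite ler_wpM2l ?sqr_ge0 //.
have V0 : 0 <= L^-1 by rewrite invr_ge0; lra.
have V1 : L^-1 <= 1 by rewrite invf_le1; lra.
have mm : m ^+ 2 / 8 <= 1 / 2 by nra.
have KK : 1 / 2 <= K / (K + 1) by rewrite ler_pdivlMr; lra.
(* What remains to be covered is (K - 1) / (2 L), at most [K * m] because [L] and [m] are at least
   1. *)
apply: (@le_trans _ _ (M / L * (1 / 2))).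
  by rewrite ler_wpM2l // divr_ge0; lra.
apply: (@le_trans _ _ ((M + 1 - K) / L * (1 / 2) + K * m)); last first.
  by rewrite lerD2r ler_wpM2l // divr_ge0; lra.
have : K / L <= K * m by rewrite ler_wpM2l; lra.
have : 0 <= K / L by rewrite divr_ge0; lra.
rewrite !mulrDl !mulNr; lra.
Qed.

End Weights.

(** * Deterministic analysis along a single noise sequence *)

Section Averages.
Context {R : realType} {n : nat}.
Implicit Types (xs : 'rV[R]_n) (x : nat -> 'rV[R]_n) (N k : nat).

Fixpoint avg_iterate N xs x k : 'rV[R]_n :=
  if k is k'.+1 then
    let u := avg_iterate N xs x k' in u + avg_weight N k' *: (x k - u)
  else xs.

Fixpoint avg_gap N (F : nat -> R) k : R :=
  if k is k'.+1 then
    let p := avg_gap N F k' in p + avg_weight N k' * (F k - p)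
  else 0.

(** The vector that [z k.+1] is paired with in the one-step inequality. It is built from earlier
    noise, so the pairing has mean zero given the past. *)
Definition tilt N xs x k : 'rV[R]_n :=
  (2 * damping N k.+1 * avg_weight N k) *: (x k.+1 - avg_iterate N xs x k).

Lemma avg_iterateE N xs x k : avg_iterate N xs x k.+1 =
  avg_weight N k *: x k.+1 + (1 - avg_weight N k) *: avg_iterate N xs x k.
Proof. by apply/rowP => i; rewrite !mxE; ring. Qed.

Lemma avg_gap_ge0 N F k : (forall t, (1 <= t)%N -> 0 <= F t) -> 0 <= avg_gap N F k.
Proof.
move=> F0; elim: k => //= k IH.
have -> : avg_gap N F k + avg_weight N k * (F k.+1 - avg_gap N F k) =
  avg_weight N k * F k.+1 + (1 - avg_weight N k) * avg_gap N F k by ring.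
by rewrite addr_ge0 // mulr_ge0 ?F0 ?avg_weight_ge0 // subr_ge0 avg_weight_le1.
Qed.

(** The difference of the two sides is a (1 - a) |p - q|^2. *)
Lemma quadratic_convex (p q : 'rV[R]_n) (a : R) : 0 <= a <= 1 ->
  dotv (a *: p + (1 - a) *: q) (a *: p + (1 - a) *: q) <=
  a * dotv p p + (1 - a) * dotv q q.
Proof.
move=> /andP[a0 a1]; have := mulr_ge0 (mulr_ge0 a0 (_ : 0 <= 1 - a)) (dotvv_ge0 (p - q)).
rewrite subr_ge0 => /(_ a1); rewrite !dotvE (dotvC q p) => h.
by rewrite -subr_ge0; apply: le_trans h _; rewrite le_eqVlt; apply/orP; left; apply/eqP; ring.
Qed.

(** The scalar core of one step: t is k + 1, b and b' are squared distances of consecutive iterates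
    to their reference points, G and Z the pairings with subgradient and noise. The distance
    inequality is multiplied by t, strong convexity is inserted, and the result is weighted by m'
    w'. *)
Lemma potential_step (m m' w w' t b b' G Z F p p' : R) :
  1 <= t -> 0 <= w' -> 0 <= m' -> m' <= m -> 0 <= p -> w' * (1 - w) = w ->
  p' = p + w * (F - p) ->
  b' <= (1 - w) ^+ 2 * b - 2 * t^-1 * ((1 - w) * (G - Z)) + 4 * t^-1 ^+ 2 ->
  F - p' + (1 - w) ^+ 2 * b / 2 <= (1 - w) * G ->
  2 * m' * p' + m' * w' * t * b' <=
  2 * m * p + m * w * (t - 1) * b + 4 * m' * w' / t + 2 * m' * w * Z
  - (t - 1) * w * (m - m' * (1 - w)) * b.
Proof.
move=> t1 w0 m0 mm p0 ww pE b'le Gge.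
have t0 : 0 < t by lra.
have tV : t * t^-1 = 1 by rewrite divff // gt_eqF.
have wp : w' * (F - p') = p' - p.
  have -> : F - p' = (1 - w) * (F - p) by rewrite pE; ring.
  by rewrite mulrA ww pE; ring.
have h1 : t * b' <= t * (1 - w) ^+ 2 * b - 2 * ((1 - w) * (G - Z)) + 4 / t.
  have := ler_wpM2l (ltW t0) b'le.
  have -> : t * ((1 - w) ^+ 2 * b - 2 * t^-1 * ((1 - w) * (G - Z)) + 4 * t^-1 ^+ 2)
    = t * (1 - w) ^+ 2 * b - 2 * (t * t^-1) * ((1 - w) * (G - Z)) +
      4 * (t * t^-1) * t^-1 by ring.
  by rewrite tV !mulr1.
(* The quadratic term of strong convexity lowers the factor t of b to t - 1, which matches the step
   sizes 1/t. *)
have h2 : t * b' <= (t - 1) * (1 - w) ^+ 2 * b - 2 * (F - p') + 2 * (1 - w) * Z + 4 / t.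
  by lra.
have h3 := ler_wpM2l (mulr_ge0 m0 w0) h2.
have e3 : m' * w' * ((t - 1) * (1 - w) ^+ 2 * b - 2 * (F - p') + 2 * (1 - w) * Z + 4 / t)
  = m' * ((t - 1) * (w' * (1 - w)) * (1 - w) * b - 2 * (w' * (F - p'))
     + 2 * (w' * (1 - w)) * Z + 4 * w' / t) by ring.
rewrite {}e3 wp ww in h3.
(* The damping may decrease in front of p because p is nonnegative. *)
have h4 : 0 <= (m - m') * p by rewrite mulr_ge0 // subr_ge0.
rewrite -subr_ge0; rewrite -subr_ge0 in h3.
have := addr_ge0 h3 (mulr_ge0 (ler0n R 2) h4); congr (_ <= _).
by ring.
Qed.

Context (X : set 'rV[R]_n) (f : 'rV[R]_n -> R) (xs : 'rV[R]_n)
  (x g z : nat -> 'rV[R]_n).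
Context (cX : euclid_convex_set X) (scf : sg_strongly_convex_on X 1 f)
  (lipf : sg_lipschitz_on X 1 f) (Xxs : X xs)
  (fmin : forall y, X y -> f xs <= f y)
  (sgf : forall t, (1 <= t)%N -> subgrad f (x t) (g t))
  (Xx1 : X (x 1%N))
  (xproj : forall t, (1 <= t)%N ->
     is_proj X (x t - (t%:R)^-1 *: (g t - z t)) (x t.+1)).

Let F t := f (x t) - f xs.
Let u N := avg_iterate N xs x.
Let phi N := avg_gap N F.

Lemma iterate_in t : (1 <= t)%N -> X (x t).
Proof. by case: t => // -[|t] _ //; have [] := xproj (isT : (1 <= t.+1)%N). Qed.

Lemma gap_ge0 t : (1 <= t)%N -> 0 <= F t.
Proof. by move=> /iterate_in/fmin; rewrite subr_ge0. Qed.

Lemma normv_subgrad_le1 t : (1 <= t)%N -> normv (g t) <= 1.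
Proof. by move=> t1; apply: lipf (iterate_in t1) (sgf t1). Qed.

Lemma strong_convexity_at t y : (1 <= t)%N -> X y ->
  f (x t) + dotv (g t) (y - x t) + dotv (y - x t) (y - x t) / 2 <= f y.
Proof.
move=> t1 Xy; have := scf (iterate_in t1) Xy (sgf t1).
by rewrite sqr_normv => h; lra.
Qed.

(** Strong convexity towards the minimizer and Cauchy-Schwarz give d^2 / 2 <= d for the distance d.
    This bounds the iterates without assuming [X] bounded. *)
Lemma dist_opt_le2 t : (1 <= t)%N -> normv (x t - xs) <= 2.
Proof.
move=> t1; have := strong_convexity_at t1 Xxs; have := gap_ge0 t1.
rewrite /F normvB -sqr_normv.
have := ler_dotv (g t) (xs - x t); rewrite ler_norml => /andP[+ _].
have := normv_subgrad_le1 t1; have := normv_ge0 (xs - x t); have := normv_ge0 (g t).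
move: (normv _) (normv _) (dotv _ _) => b a c a0 b0 a1 h1 h2 h3.
have : a * b <= b by rewrite ler_piMl.
move=> h4; have h5 : b ^+ 2 <= 2 * b by lra.
by nra.
Qed.

Lemma avg_iterate_in N k : X (u N k).
Proof.
elim: k => // k IH; rewrite /u avg_iterateE; apply: cX => //; first exact: iterate_in.
by rewrite avg_weight_ge0 avg_weight_le1.
Qed.

Lemma avg_iterate_dist_opt_le2 N k : normv (u N k - xs) <= 2.
Proof.
elim: k => [|k IH]; first by rewrite /u /= subrr normv_le // -(scale0r (0 : 'rV[R]_n)) dotvZl mul0r.
rewrite /u avg_iterateE -/u.
set w := avg_weight N k.
have -> : w *: x k.+1 + (1 - w) *: avg_iterate N xs x k - xs =
  w *: (x k.+1 - xs) + (1 - w) *: (u N k - xs).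
  by apply/rowP => i; rewrite !mxE; ring.
have w0 : 0 <= w := avg_weight_ge0 N k; have w1 : w <= 1 := avg_weight_le1 N k.
apply: le_trans (ler_normvD _ _) _; rewrite !normvZ !ger0_norm ?subr_ge0 //.
have h : (1 <= k.+1)%N by [].
have := ler_wpM2l w0 (dist_opt_le2 h); have := ler_wpM2l (_ : 0 <= 1 - w) IH.
by rewrite subr_ge0 => /(_ w1) ? ?; lra.
Qed.

(* Convexity of [f] on segments is not available: subgradients are given at the
   iterates only.  The quadratic minorant of [f] at [x t] is averaged instead. *)
Lemma strong_convexity_avg N k t : (1 <= t)%N ->
  F t + dotv (g t) (u N k - x t) + dotv (u N k - x t) (u N k - x t) / 2 <= phi N k.
Proof.
move=> t1; elim: k => [|k IH].
  by have := strong_convexity_at t1 Xxs; rewrite /F /u /phi /=; lra.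
have IHx := strong_convexity_at t1 (iterate_in (isT : (1 <= k.+1)%N)).
rewrite /u avg_iterateE -/u /phi /= -/phi.
set w := avg_weight N k.
have w0 : 0 <= w := avg_weight_ge0 N k; have w1 : w <= 1 := avg_weight_le1 N k.
have -> : w *: x k.+1 + (1 - w) *: avg_iterate N xs x k - x t =
  w *: (x k.+1 - x t) + (1 - w) *: (u N k - x t).
  by apply/rowP => i; rewrite !mxE; ring.
have w01 : 0 <= w <= 1 by rewrite w0.
have := quadratic_convex (x k.+1 - x t) (u N k - x t) w01.
move: IH IHx; rewrite /phi /F.
move: (u N k - x t) (x k.+1 - x t) => p q; rewrite (dotvDr (g t)) !(dotvZr _ (g t)).
move: (dotv (_ + _) _) => Q h1 h2 h3.
have := ler_wpM2l w0 h2; have := ler_wpM2l (_ : 0 <= 1 - w) h1.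
by rewrite subr_ge0 => /(_ w1) ? ?; lra.
Qed.

(** A Lyapunov function: the factor [k%:R] matches the step size 1/(k+1) and makes the potential
    vanish at [k = 0]. *)
Definition potential N k : R :=
  2 * damping N k * phi N k
  + damping N k * avg_weight N k * k%:R * dotv (x k.+1 - u N k) (x k.+1 - u N k).

Lemma potential_succ N k : (k < N)%N -> normv (z k.+1) <= 1 ->
  potential N k.+1 <= potential N k
    + 4 * damping N k.+1 * avg_weight N k.+1 / k.+1%:R
    + dotv (z k.+1) (tilt N xs x k)
    - k%:R * avg_weight N k * (damping N k - damping N k.+1 * (1 - avg_weight N k))
      * dotv (x k.+1 - u N k) (x k.+1 - u N k).
Proof.
move=> kN zk; have N0 : (0 < N)%N by case: (N) kN.
have k1 : (1 <= k.+1)%N by [].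
have := @potential_step (damping N k) (damping N k.+1) (avg_weight N k)
  (avg_weight N k.+1) k.+1%:R (dotv (x k.+1 - u N k) (x k.+1 - u N k))
  (dotv (x k.+2 - u N k.+1) (x k.+2 - u N k.+1)) (dotv (g k.+1) (x k.+1 - u N k))
  (dotv (z k.+1) (x k.+1 - u N k)) (F k.+1) (phi N k) (phi N k.+1).
have -> : k.+1%:R - 1 = k%:R :> R by rewrite -natr1 addrK.
rewrite /potential /tilt dotvZr => h; apply: h => //.
- by rewrite ler1n.
- exact: avg_weight_ge0.
- by apply: le_trans (damping_ge1 N0 kN).
- by rewrite -subr_ge0 damping_step invr_ge0 mulr_ge0 // harmonic_sum_ge0.
- exact: (avg_gap_ge0 _ _ gap_ge0).
- exact: avg_weightS.
(* Projecting does not increase the distance to the new reference point, which lies in [X]. *)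
- apply: le_trans (is_proj_dist_le cX (xproj k1) (avg_iterate_in N k.+1)) _.
  have -> : x k.+1 - k.+1%:R^-1 *: (g k.+1 - z k.+1) - u N k.+1 =
      (1 - avg_weight N k) *: (x k.+1 - u N k) - k.+1%:R^-1 *: (g k.+1 - z k.+1).
    by rewrite /u avg_iterateE; apply/rowP => i; rewrite !mxE; ring.
  have : dotv (g k.+1 - z k.+1) (g k.+1 - z k.+1) <= 4.
    have -> : 4 = 2 ^+ 2 :> R by rewrite -natrX.
    rewrite -normv_le //; apply: le_trans (ler_normvD _ _) _.
    by rewrite normvN; have := normv_subgrad_le1 k1; lra.
  rewrite -(dotvNl (z _)) -dotvDl.
  move: (g k.+1 - z k.+1) (x k.+1 - u N k) (k.+1%:R^-1) => e y i e4.
  have : i ^+ 2 * dotv e e <= i ^+ 2 * 4 by rewrite ler_wpM2l ?sqr_ge0.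
  by rewrite !dotvE (dotvC y e) => ?; lra.
- have := strong_convexity_avg N k.+1 k1.
  have -> : u N k.+1 - x k.+1 = - ((1 - avg_weight N k) *: (x k.+1 - u N k)).
    by rewrite /u avg_iterateE; apply/rowP => i; rewrite !mxE; ring.
  by move: (x k.+1 - u N k) => y; rewrite !dotvE => ?; lra.
Qed.

Lemma normv_tilt_le N k : (k < N)%N ->
  normv (tilt N xs x k) <= 4 * avg_weight N k * normv (x k.+1 - u N k).
Proof.
move=> kN; have N0 : (0 < N)%N by case: (N) kN.
have m1 := damping_ge1 (R := R) N0 kN; have m2 := damping_le2 (R := R) N k.+1.
have w0 := avg_weight_ge0 (R := R) N k.
rewrite /tilt normvZ ger0_norm; last first.
  by rewrite mulr_ge0 // mulr_ge0 // (le_trans ler01).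
by rewrite ler_wpM2r ?normv_ge0 // ler_wpM2r //; lra.
Qed.

(** A crude uniform bound, which makes the exponentials below bounded and hence integrable. *)
Lemma normv_tilt_le16 N k : (k < N)%N -> normv (tilt N xs x k) <= 16.
Proof.
move=> kN; apply: le_trans (normv_tilt_le kN) _.
have -> : x k.+1 - u N k = (x k.+1 - xs) - (u N k - xs).
  by apply/rowP => i; rewrite !mxE; ring.
have h : normv ((x k.+1 - xs) - (u N k - xs)) <= 4.
  apply: le_trans (ler_normvD _ _) _; rewrite normvN.
  have := dist_opt_le2 (isT : (1 <= k.+1)%N).
  by have := avg_iterate_dist_opt_le2 N k => ? ?; lra.
apply: (@le_trans _ _ (4 * 1 * 4)); last by lra.
have w0 := avg_weight_ge0 (R := R) N k; have w1 := avg_weight_le1 (R := R) N k.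
by apply: ler_pM; rewrite ?normv_ge0 ?mulr_ge0 //; lra.
Qed.

(** The noise sum starts at [j = 1] because the slack carries a factor k and vanishes at [k = 0].
    The first noise term is instead at most 8 / N, since |x_1 - xs| <= 2 and w_0 <= 1 / N. *)
Lemma potential_le N k :
  (1 <= k <= N)%N -> (forall t, (1 <= t)%N -> normv (z t) <= 1) ->
  potential N k <= 16 / N%:R + 8 * (\sum_(j < k) avg_weight N j.+1 / j.+1%:R)
    + \sum_(1 <= j < k)
        (dotv (z j.+1) (tilt N xs x j)
         - 2 * rate N * dotv (tilt N xs x j) (tilt N xs x j)).
Proof.
move=> + z1; case: k => // k /= kN; have N0 : (0 < N)%N by case: (N) kN.
have mw j : 4 * damping N j * avg_weight N j / j%:R <=
    8 * (avg_weight N j / j%:R) :> R.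
  rewrite -mulrA ler_wpM2r ?divr_ge0 ?avg_weight_ge0 //.
  by have := damping_le2 (R := R) N j; lra.
elim: k kN => [|k IH] kN.
  have zt1 := z1 _ (isT : (1 <= 1)%N).
  have := potential_succ kN zt1; rewrite {2}/potential /phi /=.
  rewrite big_geq // addr0 big_ord1 !mulr0 !mul0r subr0 !addr0 add0r => /le_trans.
  apply; rewrite addrC; apply: lerD; last exact: mw.
  apply: le_trans (ler_norm _) _; apply: le_trans (ler_dotv _ _) _.
  apply: (@le_trans _ _ (1 * (4 * avg_weight N 0 * 2))).
    apply: ler_pM; rewrite ?normv_ge0 //; apply: le_trans (normv_tilt_le kN) _.
    by rewrite ler_wpM2l ?mulr_ge0 ?avg_weight_ge0 ?dist_opt_le2.
  have : avg_weight N 0 <= (N%:R)^-1 :> R.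
    by rewrite /avg_weight subn0 lef_pV2 ?posrE ?ltr0n // ler_nat.
  have : 0 <= (N%:R)^-1 :> R by rewrite invr_ge0.
  by move: (N%:R^-1) (avg_weight _ _) => *; lra.
apply: le_trans (potential_succ kN (z1 _ _)) _ => //.
rewrite big_ord_recr big_nat_recr //=.
have kN' : (0 < k.+1 < N)%N by [].
(* The negative square left by [potential_succ] pays for 2 rate |tilt|^2: the 8 in [damping_slack]
   is this 2 times the 4 in |tilt|^2. *)
have := ler_wpM2r (dotvv_ge0 (x k.+2 - u N k.+1)) (damping_slack (R := R) kN').
have -> : dotv (tilt N xs x k.+1) (tilt N xs x k.+1) =
    4 * (damping N k.+2 * avg_weight N k.+1) ^+ 2 *
      dotv (x k.+2 - u N k.+1) (x k.+2 - u N k.+1).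
  by rewrite /tilt dotvZl dotvZr /u; ring.
have := IH (ltnW kN); have := mw k.+2.
move: (bigop _ _ _) (bigop _ _ _) (dotv (z _) _) (_ / k.+2%:R) (_ / k.+2%:R) (16 / _).
move: (dotv _ _) (potential _ _) => *; lra.
Qed.

Lemma last_gap_le N :
  (0 < N)%N -> (forall t, (1 <= t)%N -> normv (z t) <= 1) ->
  F N.+1 <= 18 / N%:R + 16 * (harmonic_sum N / N%:R)
    + \sum_(1 <= j < N)
        (dotv (z j.+1) (tilt N xs x j)
         - 2 * rate N * dotv (tilt N xs x j) (tilt N xs x j)).
Proof.
move=> N0 z1; have N0' : (0 : R) < N%:R by rewrite ltr0n.
(* The last step moves by at most |g - z| / N <= 2 / N, and the subgradient at the new point has
   norm at most 1. *)
have h1 : F N.+1 <= F N + 2 / N%:R.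
  have := sgf (isT : (1 <= N.+1)%N) (x N).
  have : normv (x N.+1 - x N) <= 2 / N%:R.
    have := is_proj_dist_le cX (xproj N0) (iterate_in N0).
    rewrite -[leRHS]sqr_normv -normv_le ?normv_ge0 // => /le_trans; apply.
    rewrite addrAC subrr add0r normvN normvZ ger0_norm ?invr_ge0 // mulrC.
    rewrite ler_wpM2r ?invr_ge0 //; apply: le_trans (ler_normvD _ _) _.
    by rewrite normvN; have := normv_subgrad_le1 N0; have := z1 _ N0 => ? ?; lra.
  have := ler_dotv (g N.+1) (x N - x N.+1); rewrite ler_norml => /andP[+ _].
  have := normv_subgrad_le1 (isT : (1 <= N.+1)%N).
  rewrite (normvB (x N)) => g1; have := ler_wpM2r (normv_ge0 (x N.+1 - x N)) g1.
  rewrite /F mul1r; move: (2 / _) (normv _ * _) => *; lra.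
have h2 : F N <= potential N N.
  have p0 : 0 <= damping N N * avg_weight N N * N%:R * dotv (x N.+1 - u N N) (x N.+1 - u N N).
    rewrite !mulr_ge0 ?avg_weight_ge0 ?dotvv_ge0 //.
    by apply: le_trans (damping_ge1 N0 _).
  have q0 k : 0 <= phi N k by exact: (avg_gap_ge0 _ _ gap_ge0).
  (* The last weight entering [phi N N] is 1/2, so this is the mean of [F N] and a nonnegative
     earlier average. *)
  have q1 : F N <= 2 * phi N N.
    case: (N) N0 q0 => // M _ q0; have := q0 M; rewrite /phi /=.
    have -> : avg_weight M.+1 M = 2^-1 by rewrite /avg_weight subSn // subSn // subnn.
    by move=> ?; lra.
  have m1 := damping_ge1 (R := R) N0 (leqnn N).
  rewrite /potential; have := ler_wpM2r (q0 N) m1; lra.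
have N1 : (1 <= N <= N)%N by rewrite N0 leqnn.
have := potential_le N1 z1; have := sum_avg_weight_harmonic (R := R) N0.
rewrite -mulrA; move: (harmonic_sum N / _) (bigop _ _ _) (bigop _ _ _) => *.
move: h1 h2; lra.
Qed.

End Averages.

(** * Measurability of Lipschitz functions and bounded integrands *)

Section RandomVectors.
Context {R : realType} {d : measure_display} {T : measurableType d}.

(* [psi] need not factor through a function defined on the whole space: a
   Lipschitz bound on the range of [y] is enough, because the open boxes with
   rational centre and radius on which [psi > c] cover [psi > c]. *)
Lemma lipschitz_measurable (n : nat) (y : T -> 'rV[R]_n) (psi : T -> R) :
  (forall i, measurable_fun setT (fun w => y w 0 i)) ->
  (forall w w', `|psi w - psi w'| <= normv (y w - y w')) ->
  measurable_fun setT psi.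
Proof.
move=> my lip; apply: (measurability _ (RGenOInfty.measurableE R)) => /= _ [_ [c ->] <-].
rewrite setTI.
pose box (q : 'rV[rat]_n * rat) : set T :=
  [set w | forall i, `|y w 0 i - ratr (q.1 0 i)| < ratr q.2].
pose good (q : 'rV[rat]_n * rat) : set T :=
  [set w | (forall w', box q w' -> c < psi w') /\ box q w].
have -> : psi @^-1` `]c, +oo[%classic = \bigcup_q good q.
  apply/seteqP; split=> w /=; rewrite in_itv /= andbT; last first.
    by move=> [q _ [h]]; apply: h.
  (* Points of the box are within 2 n e of [y w] with e < r; [n.+1] keeps the quotient meaningful
     when n = 0. *)
  move=> cw; pose r := (psi w - c) / (2 * n.+1%:R).
  have n0 : 0 < n.+1%:R :> R by rewrite ltr0n.
  have r0 : 0 < r by rewrite divr_gt0 ?subr_gt0 ?mulr_gt0.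
  have [e] := rat_in_itvoo r0; rewrite in_itv /= => /andP[e0 er].
  have hq i : exists q : rat, `|y w 0 i - ratr q| < ratr e.
    have : y w 0 i - ratr e < y w 0 i + ratr e by rewrite ltrD2l gtrN.
    move=> /rat_in_itvoo[q]; rewrite in_itv /= => /andP[h1 h2].
    by exists q; rewrite ltr_distl; apply/andP; split; lra.
  have [q hq'] := choice hq.
  exists (\row_i q i, e) => //; split; last by move=> i /=; rewrite mxE.
  move=> w' /= hw'.
  have : normv (y w - y w') <= n%:R * (2 * ratr e).
    apply: ler_normv_coords => [|i]; first by rewrite mulr_ge0 // ltW.
    have := hw' i; rewrite mxE; have := hq' i; rewrite !mxE !ltr_norml ler_norml.
    by move=> /andP[? ?] /andP[? ?]; apply/andP; split; lra.
  have : n%:R * (2 * ratr e) < psi w - c.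
    apply: (@lt_le_trans _ _ (n.+1%:R * (2 * r))).
      apply: (@le_lt_trans _ _ (n.+1%:R * (2 * ratr e))).
        by apply: ler_wpM2r; [rewrite mulr_ge0 // ltW | rewrite ler_nat].
      by rewrite ltr_pM2l // ltr_pM2l.
    rewrite /r le_eqVlt; apply/orP; left; apply/eqP; field.
    by rewrite gt_eqF.
  have := lip w w'; rewrite ler_norml => /andP[? ?] ? ?; lra.
apply: countable_bigcupT_measurable; first exact: countableP.
(* Admissibility of a box does not depend on [w], so [good q] is either empty or the whole box. *)
move=> q; have [h|h] := pselect (forall w', box q w' -> c < psi w'); last first.
  rewrite (_ : good q = set0); first exact: measurable0.
  by apply/seteqP; split=> w // [].
rewrite (_ : good q = \bigcap_(i in [set: 'I_n])
    [set w | `|y w 0 i - ratr (q.1 0 i)| < ratr q.2]); last first.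
  by apply/seteqP; split=> w /=; [move=> [_ hw] i _; exact: hw | move=> hw; split=> // i; exact: hw].
apply: fin_bigcap_measurable; first exact: finite_finset.
move=> i _; rewrite -[X in measurable X]setTI.
have : measurable_fun setT (fun w => `|y w 0 i - ratr (q.1 0 i)| < ratr q.2).
  apply: measurable_fun_ltr => //; apply: measurableT_comp => //.
  exact: measurable_funB.
by move=> /(_ measurableT [set true]); apply.
Qed.

(** For y <= M the sum is the integer part of y, written with indicators so that orthogonality
    passes to it term by term. The first conjunct carries the induction. *)
Lemma count_levels (y : R) (M : nat) : 0 <= y ->
  (M%:R <= y -> \sum_(j < M) (j.+1%:R <= y)%R%:R = M%:R :> R) /\
  (y <= M%:R -> y - 1 <= \sum_(j < M) (j.+1%:R <= y)%R%:R <= y).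
Proof.
move=> y0; elim: M => [|M [IH1 IH2]].
  by rewrite big_ord0; split=> // h; rewrite y0; lra.
have S1 : M.+1%:R <= y -> \sum_(j < M.+1) (j.+1%:R <= y)%R%:R = M.+1%:R :> R.
  move=> h; rewrite big_ord_recr /= h IH1 ?natr1 //.
  by apply: le_trans h; rewrite ler_nat.
split=> // yM; have [h|h] := leP M.+1%:R y.
  by rewrite S1 //; apply/andP; split; lra.
rewrite big_ord_recr /= (lt_geF h) addr0.
have [h2|h2] := leP M%:R y; last by apply: IH2; rewrite ltW.
by rewrite IH1 //; move: h; rewrite -natr1 => h; apply/andP; split; lra.
Qed.

Context (P : probability T R).

Lemma bounded_integrable (h : T -> R) (K : R) :
  measurable_fun setT h -> (forall w, `|h w| <= K) ->
  P.-integrable setT (EFin \o h).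
Proof.
move=> mh hK; apply: measurable_bounded_integrable => //.
  by rewrite -ge0_fin_numE // fin_num_measure.
by exists K; split; [exact: num_real|move=> M KM w _; apply: le_trans (hK w) (ltW KM)].
Qed.

Lemma bounded_integrableM (h z : T -> R) (K : R) :
  measurable_fun setT h -> (forall w, `|h w| <= K) ->
  P.-integrable setT (EFin \o z) -> P.-integrable setT (EFin \o (h \* z)).
Proof.
move=> mh hK iz.
have mz : measurable_fun setT z by apply/measurable_EFinP; apply: measurable_int iz.
apply: (le_integrable measurableT _ _ (integrableZl measurableT K iz)).
  by apply/measurable_EFinP; exact: measurable_funM.
move=> w _ /=; rewrite lee_fin !normrM ler_wpM2r //.
by apply: le_trans (hK w) (ler_norm K).
Qed.

End RandomVectors.

(** * Orthogonality of conditionally centred noise to the past *)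

Section ConditionalMean.
Context {R : realType} {d : measure_display} {T : measurableType d}.
Context (P : probability T R).

Lemma measurable_fun_coarser (G : set (set T)) (h : T -> R) :
  <<s G >> `<=` measurable ->
  measurable_fun (setT : set (g_sigma_algebraType G)) h -> measurable_fun setT h.
Proof.
move=> sG mh _ B mB; rewrite setTI; apply: sG.
by have := mh measurableT B mB; rewrite setTI.
Qed.

Context (G : set (set T)) (sG : <<s G >> `<=` measurable).

(** Orthogonality holds for indicators of events generated by [G], passes to linear combinations,
    and then to [h] by uniform approximation, with error at most E|z| / (m + 1). *)
Lemma cond_mean0_orthogonal (h z : T -> R) (K : R) :
  measurable_fun (setT : set (g_sigma_algebraType G)) h ->
  (forall w, `|h w| <= K) ->
  P.-integrable setT (EFin \o z) ->
  (forall A, <<s G >> A -> (\int[P]_(w in A) (z w)%:E = 0)%E) ->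
  \int[P]_w (h w * z w) = 0.
Proof.
move=> mh hK iz z0.
pose orth (e : T -> R) :=
  P.-integrable setT (EFin \o (e \* z)) /\ \int[P]_w (e w * z w) = 0.
have orth_bool (b : T -> bool) :
    measurable_fun (setT : set (g_sigma_algebraType G)) b ->
    orth (fun w => (b w)%:R).
  move=> mb; pose A := [set w | b w].
  have GA : <<s G >> A.
    by have := mb measurableT [set true]; rewrite setTI; apply.
  have E : (fun w => (b w)%:R * z w) = (z \_ A).
    apply/funext => w; rewrite patchE; case: ifPn => [/set_mem/= ->|].
      by rewrite mul1r.
    by rewrite notin_setE /= => /negP/negbTE ->; rewrite mul0r.
  split.
    apply: (@bounded_integrableM _ _ _ _ _ _ 1) => //.
      apply: (measurable_fun_coarser sG).
      rewrite (_ : (fun w => _) = (fun w => if b w then 1 else 0)).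
        exact: measurable_fun_ifT.
      by apply/funext => w; case: (b w).
    by move=> w; case: (b w); rewrite ?normr1 ?normr0.
  by rewrite E -Rintegral_mkcond /Rintegral z0.
have orth_lin a (e1 e2 : T -> R) : orth e1 -> orth e2 ->
    orth (fun w => a * e1 w + e2 w).
  move=> [i1 o1] [i2 o2].
  have ia : P.-integrable setT (EFin \o (fun w => a * (e1 w * z w))).
    exact: (integrableZl measurableT a i1).
  split.
    have := integrableD measurableT ia i2; congr (_.-integrable _ _).
    by apply/funext => w /=; rewrite -EFinD mulrDl mulrA.
  transitivity (\int[P]_w (a * (e1 w * z w) + e2 w * z w)).
    by apply: eq_Rintegral => w _; rewrite mulrDl mulrA.
  by rewrite RintegralD // RintegralZl // o1 o2 mulr0 addr0.
have orth1 : orth (fun=> 1) by exact: (orth_bool (fun=> true)).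
have orth0 : orth (fun=> 0) by exact: (orth_bool (fun=> false)).
have mh' := measurable_fun_coarser sG mh.
have ihz := bounded_integrableM mh' hK iz.
set B := \int[P]_w `|z w|.
have B0 : 0 <= B by apply: Rintegral_ge0.
have key (m : nat) : `|\int[P]_w (h w * z w)| <= m.+1%:R^-1 * B.
  (* An integer above [K] shifts [h] into [0, 2k]; [M] is the resulting upper bound for [y]. *)
  pose k := (Num.truncn K).+1; pose M := (m.+1 * (k + k))%N.
  have m0 : 0 < m.+1%:R :> R by rewrite ltr0n.
  have Kk : K <= k%:R by apply: ltW; exact: truncnS_gt.
  pose y w := m.+1%:R * (h w + k%:R).
  pose S w : R := \sum_(j < M) (j.+1%:R <= y w)%R%:R.
  have my : measurable_fun (setT : set (g_sigma_algebraType G)) y.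
    by apply: measurable_funM => //; apply: measurable_funD.
  have orthS : orth S.
    rewrite /S; elim: (M) => [|N IH].
      by rewrite (_ : (fun w => _) = (fun=> 0)) //; apply/funext => w; rewrite big_ord0.
    rewrite (_ : (fun w => _) = (fun w =>
      1 * (N.+1%:R <= y w)%R%:R + \sum_(j < N) (j.+1%:R <= y w)%R%:R)).
      apply: orth_lin => //; apply: orth_bool.
      exact: measurable_fun_ler.
    by apply/funext => w; rewrite big_ord_recr /= mul1r addrC.
  (* Undoing shift and scaling approximates [h] from below; the odd form fits [orth_lin]. *)
  pose s w := m.+1%:R^-1 * S w + (- k%:R * 1 + 0).
  have [is_ os] : orth s by apply: (orth_lin _ S) => //; exact: (orth_lin _ (fun=> 1)).
  pose e w := h w - s w.
  have eS w : `|e w| <= m.+1%:R^-1.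
    have := hK w; rewrite ler_norml => /andP[h1 h2].
    have y0 : 0 <= y w by rewrite mulr_ge0 //; lra.
    have yM : y w <= M%:R.
      by rewrite /M natrM natrD /y ler_wpM2l //; lra.
    have [_ /(_ yM) /andP[S1 S2]] := count_levels M y0.
    rewrite -/(S w) in S1 S2.
    have -> : e w = m.+1%:R^-1 * (y w - S w).
      by rewrite /e /s /y mulrBr mulrA mulVf ?gt_eqF //; ring.
    rewrite normrM ger0_norm ?invr_ge0 // ler_piMr ?invr_ge0 //.
    by rewrite ger0_norm; lra.
  have E : \int[P]_w (e w * z w) = \int[P]_w (h w * z w).
    transitivity (\int[P]_w (h w * z w - s w * z w)).
      by apply: eq_Rintegral => w _; rewrite mulrBl.
    by rewrite RintegralB // os subr0.
  have iez : P.-integrable setT (EFin \o (e \* z)).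
    have := integrableB measurableT ihz is_; congr (_.-integrable _ _).
    by apply/funext => w /=; rewrite -EFinB mulrBl.
  rewrite -E; apply: le_trans (le_normr_Rintegral measurableT iez) _.
  have inz := integrable_norm iz.
  rewrite /B -RintegralZl //; apply: le_Rintegral => //.
  - exact: integrable_norm iez.
  - exact: (integrableZl measurableT m.+1%:R^-1 inz).
  - by move=> w _; rewrite normrM ler_wpM2r.
apply/eqP; rewrite -normr_eq0; apply/eqP/le_anti; rewrite normr_ge0 andbT.
set a := `|_| in key *; rewrite leNgt; apply/negP => a0.
have := key (Num.truncn (B / a)); rewrite leNgt => /negP; apply.
rewrite mulrC ltr_pdivrMr ?ltr0n // mulrC -ltr_pdivrMr //.
exact: truncnS_gt.
Qed.

End ConditionalMean.

(** * One step of the exponential supermartingale *)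

Section ExponentialSupermartingale.
Context {R : realType} {n : nat} {d : measure_display} {T : measurableType d}.
Context (P : probability T R).

(** For x <= 1/2, e^x <= 1/(1-x) <= 1 + x + 2 x^2, the last step being x^2 (1 - 2x) >= 0. For x >
    1/2 already x <= 2 x^2. *)
Lemma expR_le_quadratic (x : R) : expR x <= x + expR (2 * x ^+ 2).
Proof.
have [h|h] := leP x (1 / 2).
  apply: (@le_trans _ _ (1 + x + 2 * x ^+ 2)); last first.
    by have := expR_ge1Dx (2 * x ^+ 2); lra.
  have x1 : 0 < 1 - x by lra.
  rewrite -[x in expR x]opprK expRN.
  apply: (@le_trans _ _ (1 - x)^-1).
    by rewrite lef_pV2 ?posrE ?expR_gt0 // expR_ge1Dx.
  by rewrite -[_^-1]mul1r ler_pdivrMr //; nra.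
apply: (@le_trans _ _ (expR (2 * x ^+ 2))); last by rewrite lerDr; lra.
by rewrite ler_expR; nra.
Qed.

(* [dotv z v] set to zero where [normv z <= 1] visibly fails: almost surely the
   same, but surely bounded. *)
Definition clipped_dotv (z v : 'rV[R]_n) : R :=
  if `|dotv z v| <= normv v then dotv z v else 0.

Lemma clipped_dotv_le z v : `|clipped_dotv z v| <= normv v.
Proof. by rewrite /clipped_dotv; case: ifP => // _; rewrite normr0 normv_ge0. Qed.

Lemma clipped_dotvE z v : normv z <= 1 -> clipped_dotv z v = dotv z v.
Proof.
move=> z1; rewrite /clipped_dotv ifT //; apply: le_trans (ler_dotv _ _) _.
by rewrite ler_piMl ?normv_ge0.
Qed.

Lemma measurable_dotv (d' : measure_display) (T' : measurableType d')
    (y v : T' -> 'rV[R]_n) :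
  (forall i, measurable_fun setT (fun w => y w 0 i)) ->
  (forall i, measurable_fun setT (fun w => v w 0 i)) ->
  measurable_fun setT (fun w => dotv (y w) (v w)).
Proof. by move=> my mv; apply: measurable_sum => i; exact: measurable_funM. Qed.

Lemma measurable_normv (d' : measure_display) (T' : measurableType d')
    (v : T' -> 'rV[R]_n) :
  (forall i, measurable_fun setT (fun w => v w 0 i)) ->
  measurable_fun setT (fun w => normv (v w)).
Proof.
move=> mv; apply: (lipschitz_measurable mv) => w w'.
have h a b : normv a - normv b <= normv (a - b) :> R.
  by rewrite lerBlDr -{1}(subrK b a) ler_normvD.
rewrite ler_norml h andbT lerNl opprB normvB; exact: h.
Qed.

Lemma measurable_clipped_dotv (d' : measure_display) (T' : measurableType d')
    (y v : T' -> 'rV[R]_n) :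
  (forall i, measurable_fun setT (fun w => y w 0 i)) ->
  (forall i, measurable_fun setT (fun w => v w 0 i)) ->
  measurable_fun setT (fun w => clipped_dotv (y w) (v w)).
Proof.
move=> my mv; have md := measurable_dotv my mv.
apply: measurable_fun_ifT => //.
by apply: measurable_fun_ler; [exact: measurableT_comp | exact: measurable_normv].
Qed.

(** With D the clipped pairing, e^D <= D + e^(2 D^2) <= D + e^(2 |v|^2). After multiplication by h
    e^(-2 |v|^2) the linear term integrates to zero and the other one is h. *)
Lemma expected_exp_tilt_le (G : set (set T)) (h : T -> R) (z v : T -> 'rV[R]_n)
    (K L : R) :
  <<s G >> `<=` measurable ->
  measurable_fun (setT : set (g_sigma_algebraType G)) h ->
  (forall w, 0 <= h w <= K) ->
  (forall i, measurable_fun (setT : set (g_sigma_algebraType G)) (fun w => v w 0 i)) ->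
  (forall w, normv (v w) <= L) ->
  (forall i, P.-integrable setT (fun w => (z w 0 i)%:E)) ->
  (forall i A, <<s G >> A -> (\int[P]_(w in A) (z w 0 i)%:E = 0)%E) ->
  {ae P, forall w, normv (z w) <= 1} ->
  \int[P]_w (h w * expR (clipped_dotv (z w) (v w) - 2 * dotv (v w) (v w))) <=
  \int[P]_w h w.
Proof.
move=> sG mh hK mv vL iz z0 z1.
have mzi i : measurable_fun setT (fun w => z w 0 i).
  by apply/measurable_EFinP; exact: measurable_int (iz i).
have mh' := measurable_fun_coarser sG mh.
have mvi i := measurable_fun_coarser sG (mv i).
pose D w := clipped_dotv (z w) (v w); pose q w := dotv (v w) (v w).
have mD : measurable_fun setT D by exact: measurable_clipped_dotv.
have mq : measurable_fun setT q by exact: measurable_dotv.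
have mqG : measurable_fun (setT : set (g_sigma_algebraType G)) q by exact: measurable_dotv.
have q0 w : 0 <= q w by exact: dotvv_ge0.
have h0 w : 0 <= h w by have /andP[] := hK w.
have hK' w : `|h w| <= K by rewrite ger0_norm //; have /andP[] := hK w.
have DL w : `|D w| <= L by apply: le_trans (clipped_dotv_le _ _) (vL w).
have Dq w : D w ^+ 2 <= q w.
  by rewrite /q -sqr_normv -real_normK ?num_real // lerXn2r ?nnegrE ?normv_ge0 ?clipped_dotv_le.
pose a w := h w * expR (- (2 * q w)).
have maG : measurable_fun (setT : set (g_sigma_algebraType G)) a.
  apply: measurable_funM => //; apply: measurableT_comp => //.
  by apply: measurable_funN; apply: measurable_funM.
have ma := measurable_fun_coarser sG maG.
have aK w : `|a w| <= K.
  rewrite normrM (ger0_norm (expR_ge0 _)); apply: le_trans (hK' w).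
  by rewrite ler_piMr // -[leRHS]expR0 ler_expR oppr_le0 mulr_ge0.
have iaD : P.-integrable setT (EFin \o (fun w => a w * D w)).
  apply: (bounded_integrableM ma aK); exact: bounded_integrable mD DL.
have ih : P.-integrable setT (EFin \o h) by exact: bounded_integrable mh' hK'.
(* Almost surely clipping changes nothing; then each coordinate of [z] is orthogonal to the bounded
   past-measurable factor a v_i. *)
have aD0 : \int[P]_w (a w * D w) = 0.
  transitivity (\int[P]_w (\sum_(i < n) (a w * v w 0 i) * z w 0 i)).
    congr fine; apply: ae_eq_integral => //.
    - by apply/measurable_EFinP; exact: measurable_funM.
    - apply/measurable_EFinP; apply: measurable_sum => i.
      by apply: measurable_funM => //; exact: measurable_funM.
    - apply: filterS z1 => w zw _; rewrite /D clipped_dotvE // /dotv mulr_sumr.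
      by congr (_%:E); apply: eq_bigr => i _; ring.
  have iaz i : P.-integrable setT (fun w => (a w * v w 0 i * z w 0 i)%:E).
    apply: (@bounded_integrableM _ _ _ _ (fun w => a w * v w 0 i) _ (K * L) _ _ (iz i)).
      exact: measurable_funM.
    move=> w; rewrite normrM ler_pM //.
    by apply: le_trans (ler_coord_normv _ _) (vL w).
  rewrite /Rintegral; under eq_integral do rewrite -sumEFin.
  rewrite integral_sum //= big1 // => i _.
  rewrite -[LHS]fineK; last exact: integrable_fin_num.
  congr (_%:E); apply: (cond_mean0_orthogonal (K := K * L) sG _ _ (iz i) (z0 i)).
    exact: measurable_funM.
  move=> w; rewrite normrM ler_pM //.
  by apply: le_trans (ler_coord_normv _ _) (vL w).
rewrite -[leRHS]add0r -aD0 -RintegralD //; apply: le_Rintegral => //.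
- apply: (bounded_integrableM mh' hK'); apply: (@bounded_integrable _ _ _ _ _ (expR L)).
    apply: measurableT_comp => //; apply: measurable_funB => //.
    exact: measurable_funM.
  move=> w; rewrite ger0_norm ?expR_ge0 // ler_expR -/(D w) -/(q w).
  by have := DL w; rewrite ler_norml => /andP[_ ?]; have := q0 w; lra.
- exact: (integrableD measurableT iaD ih).
- move=> w _; rewrite /a -/(D w) -/(q w) expRD.
  have e0 : 0 < expR (- (2 * q w)) by exact: expR_gt0.
  have -> : h w * expR (- (2 * q w)) * D w + h w =
      h w * (expR (- (2 * q w)) * (D w + expR (2 * q w))).
    by rewrite mulrDr (mulrC (expR (- _)) (expR _)) -expRD subrr expR0; ring.
  rewrite ler_wpM2l // mulrC ler_pM2l //.
  apply: le_trans (expR_le_quadratic _) _.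
  by rewrite lerD2l ler_expR ler_wpM2l.
Qed.

End ExponentialSupermartingale.

(** * Exponential moment and tail of the noise sum *)

Section NoiseFiltration.
Context {R : realType} {n : nat} {d : measure_display} {T : measurableType d}.
Context (P : probability T R) (z : nat -> T -> 'rV[R]_n).
Context (mz : forall t (i : 'I_n), (1 <= t)%N -> measurable_fun setT (fun w => z t w 0 i)).

(** The generators of [noise_filtration], named so that adaptedness becomes measurability over
    [g_sigma_algebraType]. *)
Definition noise_events t : set (set T) :=
  [set A | exists (s : nat) (i : 'I_n) (B : set R),
     [/\ (1 <= s <= t)%N, measurable B & A = (fun w => z s w 0 i) @^-1` B]].

Local Notation adapted t h :=
  (measurable_fun (setT : set (g_sigma_algebraType (noise_events t))) h).

Lemma noise_filtrationS t : noise_filtration z t `<=` measurable.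
Proof.
apply: smallest_sub; first exact: sigma_algebra_measurable.
move=> _ [s [i [B [/andP[s1 _] mB ->]]]].
by have := mz i s1 measurableT mB; rewrite setTI.
Qed.

Lemma adapted_le s t (h : T -> R) : (s <= t)%N -> adapted s h -> adapted t h.
Proof.
move=> st mh _ B mB.
have sub : noise_events s `<=` noise_events t.
  move=> _ [r [i [C [/andP[r1 rs] mC ->]]]].
  by exists r, i, C; split=> //; rewrite r1 (leq_trans rs).
have := mh measurableT B mB; rewrite !setTI; exact: (sub_sigma_algebra2 sub).
Qed.

Lemma adapted_noise s t i : (1 <= s <= t)%N -> adapted t (fun w => z s w 0 i).
Proof.
move=> st _ B mB; rewrite setTI; apply: sub_sigma_algebra.
by exists s, i, B.
Qed.

Context (z1 : forall t, (1 <= t)%N -> {ae P, forall w, normv (z t w) <= 1})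
  (iz : forall t (i : 'I_n), (1 <= t)%N -> P.-integrable setT (fun w => (z t w 0 i)%:E))
  (z0 : forall t (i : 'I_n) (A : set T), (1 <= t)%N ->
     noise_filtration z t.-1 A -> (\int[P]_(w in A) (z t w 0 i)%:E = 0)%E).
Context (v : nat -> T -> 'rV[R]_n) (N : nat) (L : R)
  (mv : forall k i, (k < N)%N -> adapted k (fun w => v k w 0 i))
  (vL : forall k w, (k < N)%N -> normv (v k w) <= L).

(** The exponent of the supermartingale: [S k] involves exactly z_2, ..., z_k, so it is adapted at
    [k], and both [S 0] and [S 1] are empty sums. *)
Let S k w :=
  \sum_(1 <= j < k) (clipped_dotv (z j.+1 w) (v j w) - 2 * dotv (v j w) (v j w)).

Lemma exp_sumS k w : (0 < k)%N -> expR (S k.+1 w) = expR (S k w) *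
  expR (clipped_dotv (z k.+1 w) (v k w) - 2 * dotv (v k w) (v k w)).
Proof. by move=> k0; rewrite /S big_nat_recr //=; exact: expRD. Qed.

Lemma adapted_exp_sum k : (k <= N)%N -> adapted k (fun w => expR (S k w)).
Proof.
move=> kN; apply: measurableT_comp => //.
have base : adapted k (fun=> 0 : R) by exact: measurable_cst.
elim: k kN base => [|k IH] kN base.
  by rewrite [X in adapted 0 X](_ : _ = fun=> 0) //; apply/funext => w; rewrite /S big_geq.
case: k IH kN base => [|k] IH kN base.
  by rewrite [X in adapted 1 X](_ : _ = fun=> 0) //; apply/funext => w; rewrite /S big_geq.
rewrite /S; under eq_fun do rewrite big_nat_recr //=.
have mvk i : adapted k.+2 (fun w => v k.+1 w 0 i) by apply: (adapted_le (leqnSn _)); exact: mv.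
apply: measurable_funD; first by apply: (adapted_le (leqnSn _)); exact: IH (ltnW kN) _.
apply: measurable_funB; last by apply: measurable_funM => //; exact: measurable_dotv.
by apply: measurable_clipped_dotv => // i; apply: adapted_noise; rewrite leqnn.
Qed.

Lemma exp_sum_le k w : (k <= N)%N -> expR (S k w) <= expR L ^+ k.
Proof.
elim: k => [|k IH] kN; first by rewrite /S big_geq // expR0.
have vLk := vL w kN; have L0 : 0 <= L by apply: le_trans vLk; exact: normv_ge0.
have e1 : 1 <= expR L by rewrite -expR0 ler_expR.
case: k IH kN vLk => [|k] IH kN vLk; first by rewrite /S big_geq // expR0 expr1.
rewrite exp_sumS // exprSr ler_pM ?expR_ge0 ?IH 1?ltnW // ler_expR.
have := le_trans (clipped_dotv_le (z k.+2 w) (v k.+1 w)) vLk.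
rewrite ler_norml => /andP[_ ?]; have := dotvv_ge0 (v k.+1 w); lra.
Qed.

(** The last factor is removed repeatedly by [expected_exp_tilt_le], with the earlier factors as the
    weight [h]. *)
Lemma expected_exp_sum_le1 : \int[P]_w expR (S N w) <= 1.
Proof.
suff: forall k, (k <= N)%N -> \int[P]_w expR (S k w) <= 1 by apply.
have base k : (k <= 1)%N -> \int[P]_w expR (S k w) <= 1.
  move=> k1; under eq_Rintegral do rewrite /S big_geq // expR0.
  by rewrite Rintegral_cst // mul1r /= probability_setT.
elim=> [|k IH] kN; first exact: base.
case: k IH kN => [|k] IH kN; first exact: base.
apply: le_trans (IH (ltnW kN)).
under eq_Rintegral do rewrite exp_sumS //.
have sG := @noise_filtrationS k.+1.
apply: (expected_exp_tilt_le (K := expR L ^+ k.+1) (L := L) sG).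
- exact: (adapted_exp_sum (ltnW kN)).
- by move=> w; rewrite expR_ge0 exp_sum_le // ltnW.
- by move=> i; exact: mv.
- by move=> w; exact: vL.
- by move=> i; exact: iz.
- by move=> i A; exact: (@z0 k.+2 i A isT).
- exact: z1.
Qed.

Lemma exp_sum_tail (delta : R) : 0 < delta ->
  (P [set w | (delta^-1 <= expR (S N w))%R] <= delta%:E)%E.
Proof.
move=> d0.
have mS := measurable_fun_coarser (@noise_filtrationS N) (adapted_exp_sum (leqnn N)).
have iS : P.-integrable setT (EFin \o (fun w => expR (S N w))).
  apply: (@bounded_integrable _ _ _ _ _ (expR L ^+ N)) => // w.
  by rewrite ger0_norm ?expR_ge0 // exp_sum_le.
have mA : measurable [set w | delta^-1 <= expR (S N w)].
  have mb : measurable_fun setT (fun w => delta^-1 <= expR (S N w)).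
    exact: measurable_fun_ler.
  by have := mb measurableT [set true]; rewrite setTI; apply.
have e1 : (\int[P]_w (expR (S N w))%:E <= 1)%E.
  rewrite -[leLHS]fineK; last exact: integrable_fin_num.
  by rewrite lee_fin; exact: expected_exp_sum_le1.
rewrite -[leRHS]mule1 -lee_pdivrMl //; apply: le_trans e1.
(* Markov's inequality at level 1/delta. *)
have := @le_integral_comp_abse _ _ _ P setT measurableT (EFin \o (fun w => expR (S N w)))
  delta^-1 id (@measurable_id _ _ _) (fun _ h => h) (fun _ _ _ _ h => h).
rewrite invr_gt0 setTI => /(_ _ d0) h.
have : measurable_fun setT (EFin \o (fun w => expR (S N w))) by apply/measurable_EFinP.
have -> : [set w | (delta^-1 <= expR (S N w))%R] =
    [set w | (delta^-1%:E <= `|(EFin \o (fun w => expR (S N w))) w|)%E].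
  by apply/funext => w /=; rewrite lee_fin ger0_norm ?expR_ge0.
move=> /h /le_trans; apply; rewrite le_eqVlt; apply/orP; left; apply/eqP.
by apply: eq_integral => w _ /=; rewrite ger0_norm ?expR_ge0.
Qed.

End NoiseFiltration.

(** * Adaptedness of the iterates *)

Section SGD.
Context {R : realType} {n : nat} {d : measure_display} {T : measurableType d}.
Context (X : set 'rV[R]_n) (xs x1 : 'rV[R]_n) (z g x : nat -> T -> 'rV[R]_n).
Context (cX : euclid_convex_set X)
  (mg : forall t (i : 'I_n), (1 <= t)%N ->
     measurable_wrt (noise_filtration z t.-1) (fun w => g t w 0 i))
  (x1E : forall w, x 1%N w = x1)
  (xproj : forall t w, (1 <= t)%N ->
     is_proj X (x t w - (t%:R)^-1 *: (g t w - z t w)) (x t.+1 w)).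

Local Notation adapted t h :=
  (measurable_fun (setT : set (g_sigma_algebraType (noise_events z t))) h).

(** The projection is given as a relation, not a function. Nonexpansiveness, applied to two
    outcomes, makes the new iterate Lipschitz in the unprojected point, so [lipschitz_measurable]
    applies. *)
Lemma adapted_iterate k i : adapted k (fun w => x k.+1 w 0 i).
Proof.
elim: k i => [|k IH] i.
  rewrite [X in adapted 0 X](_ : _ = fun=> x1 0 i); first exact: measurable_cst.
  by apply/funext => w; rewrite x1E.
pose y w := x k.+1 w - (k.+1%:R)^-1 *: (g k.+1 w - z k.+1 w).
apply: (@lipschitz_measurable _ _ (g_sigma_algebraType (noise_events z k.+1)) _ y) => [j|w w'].
  rewrite [X in adapted _ X](_ : _ =
      fun w => x k.+1 w 0 j - (k.+1%:R)^-1 * (g k.+1 w 0 j - z k.+1 w 0 j)).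
    apply: measurable_funB; first exact: (adapted_le (leqnSn k)).
    apply: measurable_funM; first exact: measurable_cst.
    apply: measurable_funB; last by apply: adapted_noise; rewrite leqnn.
    apply: (adapted_le (leqnSn k)) => _ B mB; rewrite setTI.
    exact: (@mg k.+1 j isT B mB).
  by apply/funext => w; rewrite !mxE.
have -> : x k.+2 w 0 i - x k.+2 w' 0 i = (x k.+2 w - x k.+2 w') 0 i by rewrite !mxE.
apply: le_trans (ler_coord_normv _ _) _.
exact: (is_proj_nonexpansive cX (@xproj k.+1 w isT) (@xproj k.+1 w' isT)).
Qed.

Lemma adapted_avg_iterate N k i :
  adapted k (fun w => avg_iterate N xs (fun t => x t w) k 0 i).
Proof.
elim: k => [|k IH] /=; first exact: measurable_cst.
have mu := adapted_le (leqnSn k) IH.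
rewrite [X in adapted _ X](_ : _ = fun w => avg_iterate N xs (fun t => x t w) k 0 i
  + avg_weight N k * (x k.+1 w 0 i - avg_iterate N xs (fun t => x t w) k 0 i)).
  apply: measurable_funD => //; apply: measurable_funM; first exact: measurable_cst.
  by apply: measurable_funB => //; apply: (adapted_le (leqnSn k)); exact: adapted_iterate.
by apply/funext => w; rewrite !mxE.
Qed.

Lemma adapted_tilt N k i (a : R) :
  adapted k (fun w => (a *: tilt N xs (fun t => x t w) k) 0 i).
Proof.
rewrite [X in adapted _ X](_ : _ = fun w => a * (2 * damping N k.+1 * avg_weight N k
  * (x k.+1 w 0 i - avg_iterate N xs (fun t => x t w) k 0 i))).
  apply: measurable_funM; first exact: measurable_cst.
  apply: measurable_funM; first exact: measurable_cst.
  by apply: measurable_funB; [exact: adapted_iterate | exact: adapted_avg_iterate].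
by apply/funext => w; rewrite !mxE.
Qed.

End SGD.

(** * From the tail bound to the rate *)

Lemma ln_ge_half (R : realType) (a : R) : 2 <= a -> 1 / 2 <= ln a.
Proof.
move=> a2; have a0 : 0 < a by lra.
have /(@le_ln1Dx R) : -1 < a^-1 - 1 by rewrite ltrBrDr addrC subrr invr_gt0.
rewrite addrCA subrr addr0 lnV ?posrE //.
have : a^-1 <= 2^-1 by rewrite lef_pV2 ?posrE.
by move=> ? ?; lra.
Qed.

Lemma probability_ge_of_ae (d : measure_display) (T : measurableType d)
    (R : realType) (P : probability T R) (A E : set T) (delta : R) :
  measurable A -> measurable E -> (P A <= delta%:E)%E ->
  {ae P, forall w, ~ A w -> E w} -> ((1 - delta)%:E <= P E)%E.
Proof.
move=> mA mE PA [B [mB B0 sB]].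
have : (P (~` E) <= delta%:E)%E.
  apply: le_trans PA; rewrite -(measureU0 mA mB B0).
  apply: le_measure; rewrite ?inE; [exact: measurableC|exact: measurableU|].
  move=> w nE; have [Aw|nA] := pselect (A w); first by left.
  by right; apply: sB => /= h; apply: nE; exact: h.
rewrite probability_setC // -(fineK (fin_num_measure P _ mE)).
by rewrite -EFinB !lee_fin => ?; lra.
Qed.

Theorem theorem3p1 (R : realType) :
  exists C : R, 0 < C /\
  forall (n : nat) (X : set 'rV[R]_n) (f : 'rV[R]_n -> R) (xstar : 'rV[R]_n)
    (d : measure_display) (Omega : measurableType d) (P : probability Omega R)
    (z g x : nat -> Omega -> 'rV[R]_n) (x1 : 'rV[R]_n) (Tn : nat) (delta : R),
  closed X -> euclid_convex_set X ->
  sg_strongly_convex_on X 1 f -> sg_lipschitz_on X 1 f ->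
  X xstar -> (forall y, X y -> f xstar <= f y) ->
  (* noise: measurable, bounded by 1 a.s., conditionally mean zero *)
  (forall t (i : 'I_n), (1 <= t)%N -> measurable_fun setT (fun w => z t w 0 i)) ->
  (forall t, (1 <= t)%N -> {ae P, forall w, normv (z t w) <= 1}) ->
  (forall t (i : 'I_n), (1 <= t)%N ->
     P.-integrable setT (fun w => (z t w 0 i)%:E)) ->
  (forall t (i : 'I_n) (A : set Omega), (1 <= t)%N ->
     noise_filtration z t.-1 A -> (\int[P]_(w in A) (z t w 0 i)%:E = 0)%E) ->
  (* g_t is a subgradient at the query point x_t, F_{t-1}-measurable *)
  (forall t w, (1 <= t)%N -> subgrad f (x t w) (g t w)) ->
  (forall t (i : 'I_n), (1 <= t)%N ->
     measurable_wrt (noise_filtration z t.-1) (fun w => g t w 0 i)) ->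
  (* projected SGD with eta_t = 1/t, started at x_1 in X *)
  X x1 -> (forall w, x 1%N w = x1) ->
  (forall t w, (1 <= t)%N ->
     is_proj X (x t w - (t%:R)^-1 *: (g t w - z t w)) (x t.+1 w)) ->
  (2 <= Tn)%N -> 0 < delta <= 1 / 2 ->
  ((1 - delta)%:E <= P [set w | (f (x Tn.+1 w) - f xstar <=
              C * (ln (Tn%:R) * ln (1 / delta)) / Tn%:R)%R])%E.
Proof.
(* With a = ln N and l = ln (1/delta), both at least 1/2, and H_N <= 1 + a <= 3a: 18 <= 72 a l, 16
   H_N <= 96 a l and 64 H_N l <= 192 a l, in total 360 a l. *)
exists 360; split=> // n X f xs d T P z g x x1 N delta _ cX scf lipf Xxs fmin mz z1 iz z0
  sgf mg Xx1 x1E xproj N2 /andP[d0 d2].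
have N0 : (0 < N)%N by apply: ltn_trans N2.
have N0' : 0 < N%:R :> R by rewrite ltr0n.
have Xx w : X (x 1%N w) by rewrite x1E.
have Xxt t w : (1 <= t)%N -> X (x t w).
  exact: (@iterate_in _ _ X (x^~ w) (g^~ w) (z^~ w) (Xx w) (fun t => @xproj t w)).
pose lam : R := rate N; have lam0 : 0 < lam by exact: rate_gt0.
(* This scaling makes the exponent [lam] times the noise sum of [last_gap_le]. *)
pose v k w := lam *: tilt N xs (x^~ w) k.
have mv k i : (k < N)%N -> measurable_fun
    (setT : set (g_sigma_algebraType (noise_events z k))) (fun w => v k w 0 i).
  by move=> _; exact: adapted_tilt cX mg x1E xproj N k i lam.
have vL k w : (k < N)%N -> normv (v k w) <= lam * 16.
  move=> kN; rewrite normvZ gtr0_norm // ler_pM2l //.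
  exact: (@normv_tilt_le16 _ _ X f xs (x^~ w) (g^~ w) (z^~ w) scf lipf Xxs fmin
    (fun t => @sgf t w) (Xx w) (fun t => @xproj t w)).
have tail := exp_sum_tail mz z1 iz z0 mv vL d0.
have mx i : measurable_fun setT (fun w => x N.+1 w 0 i).
  apply: (measurable_fun_coarser (@noise_filtrationS _ _ _ _ z mz N)).
  exact: adapted_iterate cX mg x1E xproj N i.
(* Measurability of [f] itself is not assumed; the subgradients at the iterates make [f] Lipschitz
   along them. *)
have flip w w' : f (x N.+1 w) - f (x N.+1 w') <= normv (x N.+1 w - x N.+1 w').
  have := @sgf N.+1 w isT (x N.+1 w'); have := ler_dotv (g N.+1 w) (x N.+1 w' - x N.+1 w).
  rewrite ler_norml (normvB (x N.+1 w')) => /andP[h _].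
  have := ler_wpM2r (normv_ge0 (x N.+1 w - x N.+1 w'))
    (lipf _ _ (Xxt N.+1 w isT) (@sgf N.+1 w isT)).
  by move: h; move: (_ * normv _) => b *; lra.
have mf : measurable_fun setT (fun w => f (x N.+1 w)).
  apply: (lipschitz_measurable mx) => w w'.
  by rewrite ler_norml flip andbT lerNl opprB normvB flip.
apply: probability_ge_of_ae tail _.
- have mb : measurable_fun setT (fun w => delta^-1 <= expR (\sum_(1 <= j < N)
      (clipped_dotv (z j.+1 w) (v j w) - 2 * dotv (v j w) (v j w)))).
    apply: measurable_fun_ler => //.
    apply: (measurable_fun_coarser (@noise_filtrationS _ _ _ _ z mz N)).
    exact: (adapted_exp_sum mv (leqnn N)).
  by have := mb measurableT [set true]; rewrite setTI; apply.
- have mb : measurable_fun setT (fun w => f (x N.+1 w) - f xs <=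
      360 * (ln N%:R * ln (1 / delta)) / N%:R).
    by apply: measurable_fun_ler => //; apply: measurable_funB.
  by have := mb measurableT [set true]; rewrite setTI; apply.
have z1' : {ae P, forall w, forall t, (1 <= t)%N -> normv (z t w) <= 1}.
  apply: ae_foralln => t; case: (posnP t) => [->|t1]; first exact: aeW.
  by apply: filterS (z1 _ t1) => w.
apply: filterS z1' => w zw /negP; rewrite -ltNge /=.
have := @last_gap_le _ _ X f xs (x^~ w) (g^~ w) (z^~ w) cX scf lipf Xxs fmin
    (fun t => @sgf t w) (Xx w) (fun t => @xproj t w) N N0 zw.
set S := \sum_(1 <= j < N) _ => gap.
have -> : \sum_(1 <= j < N) (clipped_dotv (z j.+1 w) (v j w) -
    2 * dotv (v j w) (v j w)) = lam * S.
  rewrite mulr_sumr; apply: eq_bigr => j _.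
  by rewrite clipped_dotvE ?zw // /v -/lam !dotvZr dotvZl; ring.
have l2 : 1 / 2 <= ln delta^-1.
  by apply: ln_ge_half; rewrite -div1r ler_pdivlMr //; lra.
have N1 : 1 / 2 <= ln N%:R :> R by apply: ln_ge_half; rewrite ler_nat.
have Hle := harmonic_sum_le_ln (R := R) N0; have H1 := harmonic_sum_ge1 (R := R) N0.
(* Off the tail event, lam S < ln (1/delta), so S is at most 64 H_N ln (1/delta) / N. *)
rewrite div1r -{1}(@lnK _ delta^-1) ?posrE ?invr_gt0 // ltr_expR.
rewrite mulrC -ltr_pdivlMr // => /ltW Sle; apply: le_trans gap _.
have lamV : ln delta^-1 / lam = 64 * (harmonic_sum N * ln delta^-1) / N%:R.
  rewrite /lam /rate; move: (ln delta^-1) => l; field.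
  by rewrite !gt_eqF //; lra.
rewrite {}lamV in Sle; apply: le_trans (lerD (lexx _) Sle) _.
rewrite mulrA -!mulrDl ler_wpM2r ?invr_ge0 //.
move: (ln delta^-1) (ln N%:R) (harmonic_sum N) l2 N1 Hle H1 => l a H.
move=> l2 a2 Ha H1.
have al : a * (1 / 2) <= a * l by rewrite ler_wpM2l; lra.
have Hl : H * l <= 3 * a * l by rewrite ler_wpM2r; lra.
lra.
Qed.
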